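(* Let $p \in [1,\infty)$, let $(X,\mathfrak{M},\mu)$ be a positive measure space, let $w : X \to \mathbb{K}$ be a measurable map such that $\varphi \cdot w \in L^p(\mu)$ for all $\varphi \in L^p(\mu)$, and let $f : X \to X$ be a bimeasurable map for which there is a constant $c \in (0,\infty)$ with $\int_A |w|^p\, d\mu \leq c\,\mu(f(A))$ for every $A \in \mathfrak{M}$ (so that $C_{w,f}(\varphi) := (\varphi \circ f)\cdot w$ is a well-defined bounded linear operator on $L^p(\mu)$). Then the weighted composition operator $C_{w,f}$ on $L^p(\mu)$ is Li-Yorke chaotic if and only if there is a nonempty countable family $(B_i)_{i \in I}$ of measurable sets of finite positive $\mu$-measure such that the following conditions hold: (A) There is an increasing sequence $(n_j)_{j \in \mathbb{N}}$ of positive integers such that $\lim_{j \to \infty} \mu_{n_j}(f^{-n_j}(B_i)) = 0$ for all $i \in I$. (B) $\displaystyle \sup\Big\{\frac{\mu_n(f^{-n}(B_i))}{\mu(B_i)} : i \in I, n \in \mathbb{N}\Big\} = \infty$.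
   Context: $\mathbb{K}$ denotes $\mathbb{R}$ or $\mathbb{C}$, and $\mathbb{N} = \{1,2,3,\ldots\}$. $L^p(\mu)$ is the Banach space over $\mathbb{K}$ of (equivalence classes of) $\mathbb{K}$-valued $p$-integrable functions with norm $\|\varphi\|_p = (\int_X |\varphi|^p d\mu)^{1/p}$. A map $f : X \to X$ is bimeasurable if $f(A) \in \mathfrak{M}$ and $f^{-1}(A) \in \mathfrak{M}$ for all $A \in \mathfrak{M}$. The positive measures $\mu_n$ on $(X,\mathfrak{M})$ are defined by $\mu_1(A) := \int_A |w|^p d\mu$ and $\mu_n(A) := \int_A |w\circ f^{n-1}|^p \cdots |w \circ f|^p |w|^p d\mu$ for $A \in \mathfrak{M}$, $n \geq 2$. $f^{-n}(B)$ is the preimage of $B$ under the iterate $f^n$. ''Countable'' includes finite; ''increasing sequence of positive integers'' means strictly increasing. A continuous map $g : M \to M$ on a metric space $(M,d)$ is Li-Yorke chaotic if there is an uncountable set $S \subset M$ such that for all distinct $x,y \in S$, $\liminf_{n \to \infty} d(g^n(x),g^n(y)) = 0$ and $\limsup_{n\to\infty} d(g^n(x),g^n(y)) > 0$. *)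

(* Defs.v *)
From HB Require Import structures.
From mathcomp Require Import all_boot all_order all_algebra.
From mathcomp Require Import complex lra.
From mathcomp Require Import all_classical all_reals all_analysis.
From mathcomp Require Import measurable_realfun.

Set Implicit Arguments.
Unset Strict Implicit.
Unset Printing Implicit Defensive.

Import Order.TTheory GRing.Theory Num.Def Num.Theory.
Import numFieldNormedType.Exports.

Local Open Scope classical_set_scope.
Local Open Scope ring_scope.

(* K is R when the kind is RealScalars and R[i] when it is ComplexScalars.
   The norm of the numFieldType R[i] is itself R[i]-valued, whence the
   R-valued modulus. *)
Variant scalars := RealScalars | ComplexScalars.
Definition scalar_field (R : realType) (k : scalars) : numFieldType :=
  match k with RealScalars => R | ComplexScalars => R[i]%C end.
Definition modulus (R : realType) (k : scalars) : scalar_field R k -> R :=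
  match k with
  | RealScalars => fun x : R => `|x|
  | ComplexScalars => fun z : R[i]%C => ComplexField.Normc.normc z
  end.
Arguments modulus {R k}.
Definition borel_scalar (R : realType) (k : scalars) :=
  g_sigma_algebraType (@open (scalar_field R k)).


Section transfer.
Context d (X : measurableType d) (R : realType).
Variable mu : {measure set X -> \bar R}.
Variables (f : X -> X) (W : X -> R) (c : R).
Hypotheses (c0 : (0 <= c)%R) (W0 : forall x, 0 <= W x) (mW : measurable_fun setT W).
Hypothesis mf : measurable_fun setT f.
Hypothesis fW : forall B, measurable B ->
  (\int[mu]_(x in f @^-1` B) (W x)%:E <= c%:E * mu B)%E.
Local Open Scope ereal_scope.
Import HBNNSimple.

Let transfer_indic B : measurable B ->
  \int[mu]_x ((\1_B (f x))%:E * (W x)%:E) <= c%:E * mu B.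
Proof.
move=> mB; apply: le_trans (fW mB).
rewrite (integral_mkcond (f @^-1` B)) le_eqVlt; apply/orP; left; apply/eqP.
apply: eq_integral => x _; rewrite indicE /patch.
have -> : (x \in f @^-1` B) = (f x \in B) by apply/idP/idP; rewrite !inE.
by case: (f x \in B); rewrite ?mul1e ?mul0e.
Qed.

Let transfer_nnsfun (h : {nnsfun X >-> R}) :
  \int[mu]_x ((h (f x))%:E * (W x)%:E) <= c%:E * \int[mu]_x (h x)%:E.
Proof.
have -> : \int[mu]_x ((h (f x))%:E * (W x)%:E) = \int[mu]_x
    (\sum_(r \in range h) (r * \1_(h @^-1` [set r]) (f x))%:E * (W x)%:E).
  apply: eq_integral => x _; rewrite fimfunE -fsumEFin// ge0_mule_fsuml//.
  by move=> r; rewrite EFinM nnfun_muleindic_ge0.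
rewrite ge0_integral_fsum//; last 2 first.
- move=> r; apply: emeasurable_funM => //; apply/measurable_EFinP => //.
  apply: measurable_funM => //.
  by apply: (@measurableT_comp _ _ _ _ _ _ (\1_(h @^-1` [set r]) : X -> R) _ f).
- move=> r x _; apply: mule_ge0; last by rewrite lee_fin.
  by rewrite EFinM nnfun_muleindic_ge0.
under [X in _ <= _ * X]eq_integral do rewrite fimfunE -fsumEFin//.
rewrite ge0_integral_fsum//; last 2 first.
- by move=> r; exact/measurable_EFinP/measurableT_comp.
- by move=> r x _; rewrite EFinM nnfun_muleindic_ge0.
rewrite ge0_mule_fsumr; last first.
  by move=> r; apply: integral_ge0 => x _; rewrite EFinM nnfun_muleindic_ge0.
apply: lee_fsum => // r [x _ <-].
rewrite integralZl_indic_nnsfun// muleCA integral_indic// setIT.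
under eq_integral do rewrite EFinM -muleA.
rewrite ge0_integralZl_EFin//; last 2 first.
- by move=> y _; rewrite mule_ge0 ?lee_fin.
- apply: emeasurable_funM => //; apply/measurable_EFinP => //.
  by apply: (@measurableT_comp _ _ _ _ _ _ (\1_(h @^-1` [set h x]) : X -> R) _ f).
by rewrite lee_wpmul2l// ?lee_fin//; exact: transfer_indic.
Qed.

Lemma ge0_integral_transfer (g : X -> \bar R) : measurable_fun setT g ->
  (forall x, 0 <= g x) ->
  \int[mu]_x (g (f x) * (W x)%:E) <= c%:E * \int[mu]_x g x.
Proof.
move=> mg g0; pose g_ := nnsfun_approx measurableT mg.
have gcvg x : (g_ n x)%:E @[n --> \oo] --> g x by exact: cvg_nnsfun_approx.
have -> : \int[mu]_x g x = limn (fun n => \int[mu]_x (g_ n x)%:E).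
  rewrite -monotone_convergence//=.
  - by apply: eq_integral => x _; apply/esym/cvg_lim.
  - by move=> n; exact/measurable_EFinP.
  - by move=> n x _; rewrite lee_fin.
  - by move=> x _ a b ab; rewrite lee_fin//; exact/lefP/nd_nnsfun_approx.
have ndg x : {homo (fun n => (g_ n (f x))%:E * (W x)%:E) : m n / (m <= n)%N >-> m <= n}.
  move=> a b ab; rewrite lee_wpmul2r ?lee_fin//; exact/lefP/nd_nnsfun_approx.
have mgf n : measurable_fun setT (fun x => (g_ n (f x))%:E * (W x)%:E).
  by apply: emeasurable_funM => //; apply/measurable_EFinP => //; apply: measurableT_comp.
have gf0 n x : 0 <= (g_ n (f x))%:E * (W x)%:E by rewrite mule_ge0 ?lee_fin.
have -> : \int[mu]_x (g (f x) * (W x)%:E) =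
    limn (fun n => \int[mu]_x ((g_ n (f x))%:E * (W x)%:E)).
  rewrite -monotone_convergence//=.
  - apply: eq_integral => x _; apply/esym/cvg_lim => //.
    by apply: cvgeZr => //; exact: gcvg.
rewrite -limeMl//; last first.
  apply/ereal_nondecreasing_is_cvgn => a b ab; apply: ge0_le_integral => //.
  - by move=> x _; rewrite lee_fin.
  - exact/measurable_EFinP.
  - exact/measurable_EFinP.
  - by move=> x _; rewrite lee_fin; exact/lefP/nd_nnsfun_approx.
apply: lee_lim.
- apply/ereal_nondecreasing_is_cvgn => a b ab; apply: ge0_le_integral => //.
  by move=> x _; exact: ndg.
- apply/ereal_nondecreasing_is_cvgn => a b ab; rewrite lee_wpmul2l ?lee_fin//.
  apply: ge0_le_integral => //.
  - by move=> x _; rewrite lee_fin.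
  - exact/measurable_EFinP.
  - exact/measurable_EFinP.
  - by move=> x _; rewrite lee_fin; exact/lefP/nd_nnsfun_approx.
- by apply: nearW => n; exact: transfer_nnsfun.
Qed.
End transfer.

Section sm.
Context d (X : measurableType d) (R : realType).
Local Notation C := R[i]%C.
Local Notation K := (scalar_field R ComplexScalars).
Local Notation Re := (@complex.Re R).
Local Notation Im := (@complex.Im R).

Lemma measurable_real_scalarP (g : X -> R) :
  measurable_fun setT (g : X -> borel_scalar R RealScalars) <->
  measurable_fun setT g.
Proof.
split=> mg.
  apply: (measurability _ (RGenOpens.measurableE R)).
  move=> _ [_ [a [b ->] <-]]; apply: (mg measurableT).
  by apply: sub_sigma_algebra; exact: interval_open.
apply: (@measurability _ _ X (borel_scalar R RealScalars) setT g (@open R) erefl) => _ [U oU <-].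
by apply: (mg measurableT); exact: open_measurable.
Qed.

Lemma abs_Re_le (z : C) : `|Re z| <= ComplexField.Normc.normc z.
Proof.
by case: z => a b /=; rewrite -sqrtr_sqr ler_wsqrtr// lerDl sqr_ge0.
Qed.
Lemma abs_Im_le (z : C) : `|Im z| <= ComplexField.Normc.normc z.
Proof.
by case: z => a b /=; rewrite -sqrtr_sqr ler_wsqrtr// lerDr sqr_ge0.
Qed.
Lemma normc_le (z : C) : ComplexField.Normc.normc z <= `|Re z| + `|Im z|.
Proof.
case: z => a b /=; rewrite -(@ger0_norm _ (`|a| + `|b|)) ?addr_ge0// -sqrtr_sqr.
rewrite ler_wsqrtr// sqrrD !real_normK ?num_real// addrAC lerDl.
by rewrite mulrn_wge0// mulr_ge0.
Qed.

Lemma ball_normc (z y : C) (e : R) : @ball K K z e%:C%C y <-> ComplexField.Normc.normc (z - y) < e.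
Proof. by rewrite /ball/= /ball_/= -ltcR. Qed.

Lemma open_complexP (U : set C) :
  @open K U <-> forall z, U z -> exists2 e : R, 0 < e & forall y, ComplexField.Normc.normc (z - y) < e -> U y.
Proof.
rewrite openE; split => [oU z /oU|oU z /oU[e e0 Ue]].
  move=> /nbhs_ballP[[e i] /=]; rewrite ltcE/= => /andP[/eqP-> e0] Ue.
  exists e => // y zy; apply: Ue; 
  exact/ball_normc.
apply/nbhs_ballP; exists e%:C%C => /=; first by rewrite ltcR.
by move=> y /ball_normc/Ue.
Qed.

Lemma measurable_complex_scalarP (g : X -> C) :
  measurable_fun setT (g : X -> borel_scalar R ComplexScalars) <->
  measurable_fun setT (Re \o g) /\ measurable_fun setT (Im \o g).
Proof.
split=> [mg|[mr mi]].
  split; apply: (measurability _ (RGenOInfty.measurableE R));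
      move=> _ [_ [a ->] <-].
    apply: (mg measurableT (Re @^-1` `]a, +oo[%classic)); apply: sub_sigma_algebra.
    apply/open_complexP => z /=; rewrite in_itv/= andbT => az.
    exists (Re z - a); rewrite ?subr_gt0// => y.
    move=> /(le_lt_trans (abs_Re_le _)); rewrite in_itv/= andbT raddfB/=.
    by move=> /(le_lt_trans (ler_norm _)); rewrite ltrD2l ltrN2.
  apply: (mg measurableT (Im @^-1` `]a, +oo[%classic)); apply: sub_sigma_algebra.
  apply/open_complexP => z /=; rewrite in_itv/= andbT => az.
  exists (Im z - a); rewrite ?subr_gt0// => y.
  move=> /(le_lt_trans (abs_Im_le _)); rewrite in_itv/= andbT raddfB/=.
  by move=> /(le_lt_trans (ler_norm _)); rewrite ltrD2l ltrN2.
apply: (@measurability _ _ X (borel_scalar R ComplexScalars) setT g (@open K) erefl) => _ [U /open_complexP oU <-].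
rewrite setTI.
pose box (a b q : rat) : set C := [set z |
  (Re z \in `]ratr a - ratr q, ratr a + ratr q[) /\
  (Im z \in `]ratr b - ratr q, ratr b + ratr q[)].
have mbox a b q : measurable (g @^-1` box a b q).
  rewrite (_ : _ @^-1` _ =
      (Re \o g) @^-1` `]ratr a - ratr q, ratr a + ratr q[%classic `&`
      (Im \o g) @^-1` `]ratr b - ratr q, ratr b + ratr q[%classic); last first.
    by apply/seteqP; split.
  apply: measurableI; rewrite -[_ @^-1` _]setTI; [exact: mr | exact: mi].
rewrite (_ : U = \bigcup_a \bigcup_b \bigcup_q
    [set z | box a b q `<=` U /\ box a b q z]); last first.
  apply/seteqP; split => [z Uz|z [a _ [b _ [q _ [+ ?]]]]]; last exact.
  have [e e0 Ue] := oU z Uz.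
  have [q] := rat_in_itvoo (divr_gt0 e0 (ltr0n R 4)).
  rewrite in_itv/= => /andP[q0 qe].
  have near (r : R) : exists a : rat, (r \in `]ratr a - ratr q, ratr a + ratr q[).
    have rq : r - ratr q < r + ratr q by lra.
    have [a] := rat_in_itvoo rq.
    by rewrite in_itv/= => /andP[? ?]; exists a; rewrite in_itv/=; lra.
  have [a za] := near (Re z); have [b zb] := near (Im z).
  exists a => //; exists b => //; exists q => //; split=> // y [ya yb].
  apply: Ue; apply: (le_lt_trans (normc_le _)).
  move: za zb ya yb; rewrite !in_itv/= !raddfB/=.
  move=> /andP[? ?] /andP[? ?] /andP[? ?] /andP[? ?].
  have : `|Re z - Re y| < 2 * ratr q by rewrite ltr_norml; lra.
  have : `|Im z - Im y| < 2 * ratr q by rewrite ltr_norml; lra.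
  lra.
rewrite preimage_bigcup.
apply: bigcupT_measurable_rat => a; rewrite preimage_bigcup.
apply: bigcupT_measurable_rat => b; rewrite preimage_bigcup.
apply: bigcupT_measurable_rat => q.
have [bU|nbU] := pselect (box a b q `<=` U).
  rewrite (_ : _ @^-1` _ = g @^-1` box a b q)//.
  by apply/seteqP; split => x //= [].
rewrite (_ : _ @^-1` _ = set0)//.
by apply/seteqP; split => x //= [].
Qed.
End sm.

Section modulus_theory.
Context (R : realType) (k : scalars).
Implicit Types x y z : scalar_field R k.

Lemma modulus_ge0 x : 0 <= modulus x.
Proof. by case: k x => /= x; [exact: normr_ge0|case: x => a b; exact: sqrtr_ge0]. Qed.

Lemma modulus0 : modulus (0 : scalar_field R k) = 0.
Proof. by case: k => /=; [exact: normr0|exact: ComplexField.Normc.normc0]. Qed.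

Lemma modulus0_eq0 x : modulus x = 0 -> x = 0.
Proof. by case: k x => /= x; [exact: normr0_eq0|exact: ComplexField.Normc.eq0_normc]. Qed.

Lemma modulusM x y : modulus (x * y) = modulus x * modulus y.
Proof. by case: k x y => /= x y; [exact: normrM|exact: ComplexField.Normc.normcM]. Qed.

Lemma modulusD x y : modulus (x + y) <= modulus x + modulus y.
Proof. by case: k x y => /= x y; [exact: ler_normD|exact: le_normcD]. Qed.

Lemma modulusN x : modulus (- x) = modulus x.
Proof. by case: k x => /= x; [exact: normrN|exact: (@normcN R)]. Qed.

Lemma modulusBC x y : modulus (x - y) = modulus (y - x).
Proof. by rewrite -modulusN opprB. Qed.

Lemma modulusB_triangle y x z :
  modulus (x - z) <= modulus (x - y) + modulus (y - z).
Proof. by rewrite -[X in modulus X <= _](subrKA y) modulusD. Qed.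

End modulus_theory.

Section measurable_scalar_ops.
Context d (X : measurableType d) (R : realType) (k : scalars).
Implicit Types g h : X -> scalar_field R k.
Local Notation mscalar g := (measurable_fun setT (g : X -> borel_scalar R k)).

Lemma measurable_scalarM g h : mscalar g -> mscalar h ->
  mscalar (fun x => g x * h x).
Proof.
case: k g h => g h.
  move=> /measurable_real_scalarP mg /measurable_real_scalarP mh.
  by apply/measurable_real_scalarP; exact: measurable_funM.
move=> /measurable_complex_scalarP[gr gi] /measurable_complex_scalarP[hr hi].
apply/measurable_complex_scalarP; split.
  rewrite (_ : _ \o _ =
    (fun x => complex.Re (g x) * complex.Re (h x) - complex.Im (g x) * complex.Im (h x))).
    by apply: measurable_funB; exact: measurable_funM.
  by apply/funext => x /=; case: (g x) (h x) => [? ?] [? ?].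
rewrite (_ : _ \o _ =
    (fun x => complex.Re (g x) * complex.Im (h x) + complex.Im (g x) * complex.Re (h x))).
  by apply: measurable_funD; exact: measurable_funM.
by apply/funext => x /=; case: (g x) (h x) => [? ?] [? ?].
Qed.

Lemma measurable_scalarB g h : mscalar g -> mscalar h ->
  mscalar (fun x => g x - h x).
Proof.
case: k g h => g h.
  move=> /measurable_real_scalarP mg /measurable_real_scalarP mh.
  by apply/measurable_real_scalarP; exact: measurable_funB.
move=> /measurable_complex_scalarP[gr gi] /measurable_complex_scalarP[hr hi].
apply/measurable_complex_scalarP; split.
  rewrite (_ : _ \o _ = (fun x => complex.Re (g x) - complex.Re (h x))).
    exact: measurable_funB.
  by apply/funext => x /=; case: (g x) (h x) => [? ?] [? ?].
rewrite (_ : _ \o _ = (fun x => complex.Im (g x) - complex.Im (h x))).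
  exact: measurable_funB.
by apply/funext => x /=; case: (g x) (h x) => [? ?] [? ?].
Qed.

Lemma measurable_modulus g : mscalar g ->
  measurable_fun setT (fun x => modulus (g x)).
Proof.
case: k g => g.
  by move=> /measurable_real_scalarP mg; exact: measurableT_comp.
move=> /measurable_complex_scalarP[gr gi].
rewrite (_ : (fun _ => _) = fun x =>
  Num.sqrt (complex.Re (g x) ^+ 2 + complex.Im (g x) ^+ 2)).
  apply: (@measurableT_comp _ _ _ _ _ _ (@Num.sqrt R)).
    by apply: continuous_measurable_fun; exact: sqrt_continuous.
  by apply: measurable_funD; exact: measurable_funX.
by apply/funext => x /=; case: (g x).
Qed.

End measurable_scalar_ops.

Local Open Scope quotient_scope.

Section Lp.
Context d (X : measurableType d) (R : realType) (k : scalars).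
Variables (mu : {measure set X -> \bar R}) (p : R).

Definition is_Lp (phi : X -> scalar_field R k) :=
  measurable_fun setT (phi : X -> borel_scalar R k) /\
  finite_norm mu p%:E (modulus \o phi).

Definition Lp_edist (phi psi : X -> scalar_field R k) : \bar R :=
  'N[mu]_p%:E [EFin \o (fun x => modulus (phi x - psi x))].

Record Lp_fun := MkLp { Lp_val :> X -> scalar_field R k ; Lp_valP : is_Lp Lp_val }.

HB.instance Definition _ := gen_eqMixin Lp_fun.
HB.instance Definition _ := gen_choiceMixin Lp_fun.

Definition Lp_eqv (phi psi : Lp_fun) := `[< phi = psi %[ae mu] >].

Let Lp_eqv_refl : reflexive Lp_eqv.
Proof. by move=> phi; apply/asboolP; exact: ae_eq_refl. Qed.

Let Lp_eqv_sym : symmetric Lp_eqv.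
Proof. by move=> phi psi; apply/idP/idP => /asboolP h; apply/asboolP/ae_eq_sym. Qed.

Let Lp_eqv_trans : transitive Lp_eqv.
Proof. by move=> f g h /asboolP gf /asboolP fh; apply/asboolP/(ae_eq_trans gf fh). Qed.

Canonical Lp_eqv_canonical := EquivRel Lp_eqv Lp_eqv_refl Lp_eqv_sym Lp_eqv_trans.

Hypothesis p1 : 1 <= p.
Let p0 : 0 < p. Proof. exact: lt_le_trans p1. Qed.

Lemma measurable_Lp_modulusB (phi psi : Lp_fun) : measurable_fun setT (fun x => modulus (phi x - psi x)).
Proof.
by apply: measurable_modulus; apply: measurable_scalarB;
  [exact: (Lp_valP phi).1|exact: (Lp_valP psi).1].
Qed.

#[local] Hint Extern 0 (measurable_fun _ (fun _ => modulus _)) =>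
  solve [exact: measurable_Lp_modulusB] : core.

Lemma le_Lnorm (g h : X -> R) : measurable_fun setT g -> measurable_fun setT h ->
  (forall x, 0 <= g x <= h x) ->
  ('N[mu]_p%:E [EFin \o g] <= 'N[mu]_p%:E [EFin \o h])%E.
Proof.
move=> mg mh gh; rewrite unlock; apply: gt0_ler_poweR.
- by rewrite invr_ge0 ltW.
- by rewrite in_itv/= leey andbT; apply: integral_ge0 => x _; rewrite lee_fin powR_ge0.
- by rewrite in_itv/= leey andbT; apply: integral_ge0 => x _; rewrite lee_fin powR_ge0.
apply: ge0_le_integral => //=.
- apply/measurable_EFinP; apply: (@measurableT_comp _ _ _ _ _ _ (fun y => y `^ p)) => //.
  exact: measurableT_comp.
- apply/measurable_EFinP; apply: (@measurableT_comp _ _ _ _ _ _ (fun y => y `^ p)) => //.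
  exact: measurableT_comp.
move=> x _; have /andP[g0 ghx] := gh x; have h0 := le_trans g0 ghx.
by rewrite lee_fin !ger0_norm// ge0_ler_powR// ltW.
Qed.

Lemma Lp_edist_triangle (psi phi chi : Lp_fun) : (Lp_edist phi chi <= Lp_edist phi psi + Lp_edist psi chi)%E.
Proof.
apply: (@le_trans _ _ ('N[mu]_p%:E [EFin \o
   ((fun x => modulus (phi x - psi x)) \+ (fun x => modulus (psi x - chi x)))%R])%E).
  apply: le_Lnorm => //; first exact: measurable_funD.
  by move=> x; rewrite modulus_ge0 modulusB_triangle.
exact: minkowski_EFin.
Qed.

Lemma Lp_edist_fin_num (phi psi : Lp_fun) : Lp_edist phi psi \is a fin_num.
Proof.
rewrite ge0_fin_numE ?Lnorm_ge0//.
have [[mphi fphi] [mpsi fpsi]] := (Lp_valP phi, Lp_valP psi).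
apply: (@le_lt_trans _ _ ('N[mu]_p%:E [EFin \o
   ((modulus \o phi) \+ (modulus \o psi))%R])%E).
  apply: le_Lnorm => //.
    by apply: measurable_funD; exact: measurable_modulus.
  move=> x; rewrite modulus_ge0/=; apply: (le_trans (modulusD _ _)).
  by rewrite modulusN.
apply: (le_lt_trans (minkowski_EFin _ _ _ _)) => //.
- exact: measurable_modulus.
- exact: measurable_modulus.
- exact: lte_add_pinfty.
Qed.

Lemma Lp_edist_eq0 (phi psi : Lp_fun) : phi = psi %[ae mu] <-> Lp_edist phi psi = 0%E.
Proof.
split=> [e|].
  rewrite /Lp_edist unlock; rewrite (_ : (\int[mu]_x _)%E = 0%E).
    by rewrite poweR0r// invr_neq0// gt_eqF.
  rewrite -(integral0 mu setT); apply: ge0_ae_eq_integral => //=.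
  - apply/measurable_EFinP; apply: (@measurableT_comp _ _ _ _ _ _ (fun y => y `^ p)) => //.
    exact: measurableT_comp.
  - move: e; apply: filterS => x /= /(_ I) -> _.
    by rewrite subrr modulus0 normr0 powR0// gt_eqF.
move=> /Lnorm_eq0_eq0 h.
have : EFin \o (fun x => modulus (phi x - psi x)) = \0%E %[ae mu].
  by apply: h; [exact/measurable_EFinP | rewrite lte_fin].
apply: filterS => x /= /(_ I) [] /modulus0_eq0 /eqP.
by rewrite subr_eq0 => /eqP.
Qed.

(* The proof of 1 <= p is carried by the type so that the metric instance below,
   which needs Minkowski's inequality, can be inferred from it. *)
Definition Lp_space (_ : 1 <= p) : Type := {eq_quot Lp_eqv}.
Local Notation Lp := (Lp_space p1).
HB.instance Definition _ := Choice.on Lp.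
HB.instance Definition _ := EqQuotient.on Lp.

Lemma Lp_eqP (phi psi : Lp_fun) :
  \pi_Lp%qT phi = \pi_Lp%qT psi <-> phi = psi %[ae mu].
Proof. by split => [/eqP|e]; [|apply/eqP]; rewrite eqmodE; [move/asboolP|apply/asboolP]. Qed.

Let repr_ae (phi : Lp_fun) : repr (\pi_Lp%qT phi) = phi %[ae mu].
Proof. by apply/Lp_eqP; rewrite reprK. Qed.

Definition Lp_mdist (u v : Lp) : R := fine (Lp_edist (repr u) (repr v)).

Let Lp_mdistxx u : Lp_mdist u u = 0.
Proof. have N0 : Lp_edist (repr u) (repr u) = 0%E by apply/Lp_edist_eq0; exact: ae_eq_refl.
by rewrite /Lp_mdist N0.
Qed.

Let Lp_mdist_eq0 u v : Lp_mdist u v = 0 -> u = v.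
Proof.
move=> /eqP; rewrite fine_eq0; last exact: Lp_edist_fin_num.
move=> /eqP /Lp_edist_eq0 /Lp_eqP.
by rewrite !reprK.
Qed.

Let Lp_mdistC u v : Lp_mdist u v = Lp_mdist v u.
Proof.
by rewrite /Lp_mdist; congr (fine (Lnorm _ _ _)); apply/funext => x /=;
  rewrite modulusBC.
Qed.

Let Lp_mdist_triangle v u t : Lp_mdist u t <= Lp_mdist u v + Lp_mdist v t.
Proof.
rewrite -lee_fin EFinD /Lp_mdist.
by rewrite (fineK (Lp_edist_fin_num _ _)) !(fineK (Lp_edist_fin_num _ _)) Lp_edist_triangle.
Qed.

HB.instance Definition _ := isMetric.Build R Lp
  Lp_mdistxx Lp_mdist_eq0 Lp_mdistC Lp_mdist_triangle.

Lemma Lp_mdistE (phi psi : Lp_fun) :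
  mdist (\pi_Lp%qT phi) (\pi_Lp%qT psi) = fine (Lp_edist phi psi).
Proof.
have N0 (u v : Lp_fun) : u = v %[ae mu] -> Lp_edist u v = 0%E by move/Lp_edist_eq0.
have le (a b a' b' : Lp_fun) : a = a' %[ae mu] -> b = b' %[ae mu] ->
    (Lp_edist a b <= Lp_edist a' b')%E.
  move=> aa' bb'; apply: (le_trans (Lp_edist_triangle a' _ _)).
  rewrite N0// add0e; apply: (le_trans (Lp_edist_triangle b' _ _)).
  by rewrite (N0 b' b) ?adde0//; exact: ae_eq_sym.
rewrite /mdist/= /Lp_mdist; congr fine; apply/eqP; rewrite eq_le.
by rewrite !le//; apply: ae_eq_sym; exact: repr_ae.
Qed.

End Lp.
(* The inferior and superior limits are taken in the extended reals, where they
   exist even if the distances are unbounded. *)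
Definition li_yorke_chaotic (R : realType) (M : metricType R) (g : M -> M) :=
  continuous g /\
  exists S : set M, ~ countable S /\
    forall x y, S x -> S y -> x <> y ->
      limn_einf (fun n => (mdist (iter n g x) (iter n g y))%:E) = 0%E /\
      (0 < limn_esup (fun n => (mdist (iter n g x) (iter n g y))%:E))%E.

Definition bimeasurable d (X : measurableType d) (f : X -> X) :=
  (forall A, measurable A -> measurable (f @` A)) /\
  (forall A, measurable A -> measurable (f @^-1` A)).

Section weighted_composition.
Context d (X : measurableType d) (R : realType) (k : scalars).
Variables (mu : {measure set X -> \bar R}) (p : R).
Variables (w : X -> scalar_field R k) (f : X -> X).

(* The measure \mu_n when n >= 1; for n = 0 the product is empty. *)
Definition weighted_measure (n : nat) (A : set X) : \bar R :=
  \int[mu]_(x in A) (\prod_(i < n) modulus (w (iter i f x)) `^ p)%:E.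

Definition weighted_comp (phi : X -> scalar_field R k) : X -> scalar_field R k :=
  fun x => phi (f x) * w x.

Hypothesis p1 : 1 <= p.
Local Notation Lp := (Lp_space k mu p1).

(* Defined through a representative of the class; weighted_comp_opE below shows
   that the choice is immaterial. *)
Definition weighted_comp_op
    (C_Lp : forall phi, is_Lp mu p phi -> is_Lp mu p (weighted_comp phi))
    (u : Lp) : Lp :=
  \pi_Lp (MkLp (C_Lp (repr u) (Lp_valP (repr u)))).

Hypothesis mw : measurable_fun setT (w : X -> borel_scalar R k).
Hypothesis f_bimeas : bimeasurable f.

Let p0 : 0 < p. Proof. exact: lt_le_trans p1. Qed.

Let mf : measurable_fun setT f.
Proof. by move=> _ A mA; rewrite setTI; exact: f_bimeas.2. Qed.

Let Lnorm_weighted_comp c (g : X -> R) : 0 < c ->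
  (forall A, measurable A ->
    \int[mu]_(x in A) (modulus (w x) `^ p)%:E <= c%:E * mu (f @` A))%E ->
  measurable_fun setT g ->
  ('N[mu]_p%:E [EFin \o (fun x => g (f x) * modulus (w x))%R] <=
   (c `^ p^-1)%:E * 'N[mu]_p%:E [EFin \o g])%E.
Proof.
move=> c0 wc mg; rewrite unlock.
have I0 (h : X -> R) : (0 <= \int[mu]_x (`|(h x)%:E| `^ p))%E.
  by apply: integral_ge0 => x _; rewrite lee_fin powR_ge0.
rewrite -poweR_EFin -poweRM ?lee_fin ?(ltW c0)//; last exact: I0.
apply: gt0_ler_poweR.
- by rewrite invr_ge0 ltW.
- by rewrite in_itv/= leey andbT; exact: I0.
- by rewrite in_itv/= leey andbT mule_ge0 ?lee_fin ?(ltW c0)//; exact: I0.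
rewrite [leLHS](_ : _ = \int[mu]_x ((`|g (f x)| `^ p)%:E * (modulus (w x) `^ p)%:E))%E.
  apply: (@ge0_integral_transfer _ _ _ mu f (fun x => modulus (w x) `^ p) c
    _ _ _ _ _ (fun y => (`|g y| `^ p)%:E)) => //.
  - exact: ltW.
  - by move=> x; exact: powR_ge0.
  - apply: (@measurableT_comp _ _ _ _ _ _ (fun y => y `^ p)) => //.
    exact: measurable_modulus.
  - move=> B mB; apply: (le_trans (wc _ _)); first exact: f_bimeas.2.
    rewrite lee_wpmul2l ?lee_fin ?(ltW c0)//; apply: le_measure.
    + by rewrite inE; apply: f_bimeas.1; exact: f_bimeas.2.
    + by rewrite inE.
    + exact: image_preimage_subset.
  - apply/measurable_EFinP; apply: (@measurableT_comp _ _ _ _ _ _ (fun y => y `^ p)) => //.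
    exact: measurableT_comp.
apply: eq_integral => x _ /=.
by rewrite normrM powRM// EFinM (ger0_norm (modulus_ge0 _)).
Qed.

Hypothesis f_bound : exists c : R, 0 < c /\
  forall A, measurable A ->
    (\int[mu]_(x in A) (modulus (w x) `^ p)%:E <= c%:E * mu (f @` A))%E.

Lemma is_Lp_weighted_comp (phi : X -> scalar_field R k) :
  is_Lp mu p phi -> is_Lp mu p (weighted_comp phi).
Proof.
move=> [mphi fphi]; split.
  apply: measurable_scalarM => //.
  exact: (@measurableT_comp _ _ _ _ _ _ (phi : X -> borel_scalar R k) _ f).
have [c [c0 wc]] := f_bound.
rewrite /finite_norm (_ : modulus \o weighted_comp phi =
    fun x => (modulus \o phi) (f x) * modulus (w x)).
  apply: le_lt_trans (Lnorm_weighted_comp c0 wc _) _.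
    exact: measurable_modulus.
  by rewrite lte_mul_pinfty// lee_fin powR_ge0.
by apply/funext => x /=; rewrite modulusM.
Qed.

Local Notation C := (weighted_comp_op is_Lp_weighted_comp).

Let Lp_edist_weighted_comp c (phi psi : Lp_fun k mu p) : 0 < c ->
  (forall A, measurable A ->
    \int[mu]_(x in A) (modulus (w x) `^ p)%:E <= c%:E * mu (f @` A))%E ->
  (Lp_edist mu p (weighted_comp phi) (weighted_comp psi) <=
   (c `^ p^-1)%:E * Lp_edist mu p phi psi)%E.
Proof.
move=> c0 wc.
rewrite /Lp_edist (_ : (fun x => modulus (weighted_comp phi x - _)) =
    fun x => (fun y => modulus (phi y - psi y)) (f x) * modulus (w x)).
  apply: Lnorm_weighted_comp => //; exact: measurable_Lp_modulusB.
by apply/funext => x; rewrite /weighted_comp -mulrBl modulusM.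
Qed.

Lemma weighted_comp_opE (phi : Lp_fun k mu p) :
  C (\pi_Lp phi) = \pi_Lp (MkLp (is_Lp_weighted_comp (Lp_valP phi))).
Proof.
apply/Lp_eqP/(Lp_edist_eq0 p1); have [c [c0 wc]] := f_bound.
apply/eqP; rewrite eq_le Lnorm_ge0 andbT.
apply: (le_trans (Lp_edist_weighted_comp _ _ c0 wc)).
have /(Lp_edist_eq0 p1)-> : repr (\pi_Lp phi) = phi %[ae mu].
  by apply/(Lp_eqP p1); rewrite reprK.
by rewrite mule0.
Qed.

Lemma weighted_comp_op_continuous : continuous C.
Proof.
have [c [c0 wc]] := f_bound; have K0 : 0 < c `^ p^-1 by exact: powR_gt0.
have lip u v : mdist (C u) (C v) <= c `^ p^-1 * mdist u v.
  rewrite /weighted_comp_op Lp_mdistE -[u in mdist u v]reprK -[v in mdist _ v]reprK.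
  rewrite Lp_mdistE -lee_fin EFinM !(fineK (Lp_edist_fin_num p1 _ _)).
  exact: Lp_edist_weighted_comp.
move=> u; apply/(@metricType_numDomainType.cvgrPdist_lt R Lp Lp (nbhs u)
  (nbhs_filter u)) => e e0.
have := @metricType_numDomainType.cvgr_dist_lt R Lp Lp (nbhs u) (nbhs_filter u)
  id u cvg_id (e / c `^ p^-1) (divr_gt0 e0 K0).
apply: filterS => v; rewrite ltr_pdivlMr// mulrC; exact: le_lt_trans.
Qed.

End weighted_composition.

(* Main.v *)
(* Put v = |w|^p, W_n = \prod_(i < n) v \o f^i and J_n g = \int g(f^n x) W_n(x) dmu,
   so that ||C^n phi||^p = J_n |phi|^p and mu_n(f^-n(B)) = J_n 1_B; the bound on
   w and f gives J_(m+n) g <= c^m J_n g.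

   If x <> y is a Li-Yorke pair, then g = |x - y|^p satisfies liminf J_n g = 0 and
   limsup J_n g > 0.  The B_i are the level sets, at nonzero levels, of the simple
   functions approximating the densities g_m = (g \o f^m) W_m of all the orbit.
   Since g_m dominates a positive multiple of 1_(B_i), and J_n g_m = J_(m+n) g <=
   c^m J_n g, (A) holds along any n_j with J_(n_j) g -> 0.  If the ratios in (B)
   were bounded by M, then J_(m+n) g <= M J_m g for all m and n, and J_n g -> 0.

   Conversely (B) gives for every N a multiple h_N of some 1_(B_i) with
   (c + 1)^N \int h_N <= 4^-N and J_m h_N >= 1 for some m > N.  By (A) there is a sparse
   sequence N_0 < N_1 < ... such that g = \sum_l h_(N_l) has J_(N_k) g -> 0, while
   positivity of the humps gives J_m g >= 1 for infinitely many m.  The multiples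
   t g^(1/p), t in [0, 1], then form an uncountable scrambled set. *)
Require Import Defs.
From HB Require Import structures.
From mathcomp Require Import all_boot all_order all_algebra.
From mathcomp Require Import complex ring.
From mathcomp Require Import all_classical all_reals all_analysis.
From mathcomp Require Import measurable_realfun.
Import Order.TTheory GRing.Theory Num.Theory.
Import numFieldNormedType.Exports.
Local Open Scope classical_set_scope.
Local Open Scope ring_scope.

Set Implicit Arguments.
Unset Strict Implicit.

(** * Extraction of sequences of times *)

Lemma exists_increasing_cvg0 (R : realType) (u : nat -> \bar R) :
  (forall n, 0 <= u n)%E ->
  (forall e : R, 0 < e -> forall N, exists2 n, (N <= n)%N & (u n < e%:E)%E) ->
  exists n : nat -> nat, [/\ forall j, (0 < n j)%N,
    {homo n : a b / (a < b)%N} & u (n j) @[j --> \oo] --> 0%E].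
Proof.
move=> u0 uN.
have /choice[F FP] (Nj : nat * nat) :
    exists n, (Nj.1 < n)%N /\ (u n < (harmonic Nj.2)%:E)%E.
  by have [|n Nn un] := uN (harmonic Nj.2) _ Nj.1.+1; [exact: harmonic_gt0|exists n].
(* [F (a, j)] lies strictly beyond [a] and makes [u] smaller than [harmonic j]. The first index is
   sought beyond 0, so all indices are positive. *)
pose n := fix n j := if j is i.+1 then F (n i, j) else F (0%N, 0%N).
have un j : (u (n j) < (harmonic j)%:E)%E by case: j => [|j]; exact: (FP _).2.
exists n; split.
- by case=> [|j]; exact: leq_ltn_trans (FP _).1.
- by apply: homo_ltn; [exact: ltn_trans|move=> j; exact: (FP (n j, j.+1)).1].
- apply: (@squeeze_cvge _ _ _ _ (cst 0%E) _ (fun j => (harmonic j)%:E)).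
  + by apply: nearW => j; rewrite u0 ltW.
  + exact: cvg_cst.
  + by apply: cvg_EFin; [exact: nearW|exact: cvg_harmonic].
Qed.

(* [nu n B] stands for mu_n(f^-n(B)). *)
Definition li_yorke_family d (X : measurableType d) (R : realType)
    (mu : {measure set X -> \bar R}) (nu : nat -> set X -> \bar R)
    (I : Type) (B : I -> set X) :=
  [/\ countable [set: I] /\ [set: I] !=set0,
      forall i, measurable (B i) /\ (0 < mu (B i) < +oo)%E,
      exists n : nat -> nat,
        [/\ forall j, (0 < n j)%N,
            {homo n : a b / (a < b)%N} &
            forall i, nu (n j) (B i) @[j --> \oo] --> 0%E]
    & ereal_sup [set r : \bar R | exists (i : I) (n : nat), (0 < n)%N /\
        r = (nu n (B i) / mu (B i))%E] = +oo%E].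

(** * Iterated weights and orbit integrals *)

Section weighted_iterates.
Context d (X : measurableType d) (R : realType).
Variables (mu : {measure set X -> \bar R}) (f : X -> X) (v : X -> R) (c : R).
Hypothesis mf : measurable_fun setT f.
Hypothesis mv : measurable_fun setT v.
Hypothesis v0 : forall x, 0 <= v x.
Hypothesis c0 : 0 <= c.
Hypothesis v_bound : forall B, measurable B ->
  (\int[mu]_(x in f @^-1` B) (v x)%:E <= c%:E * mu B)%E.

Definition iter_weight n x : R := \prod_(i < n) v (iter i f x).

(** [g] is extended-real so that it may be the sum of a series of humps, which can diverge at some
    points. *)
Definition iter_integral n (g : X -> \bar R) : \bar R :=
  \int[mu]_x (g (iter n f x) * (iter_weight n x)%:E)%E.

Local Notation J := iter_integral.

Lemma measurable_iter n : measurable_fun setT (iter n f).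
Proof.
by elim: n => [|n IH]; [exact: measurable_id|exact: measurableT_comp].
Qed.

Lemma iter_weight_ge0 n x : 0 <= iter_weight n x.
Proof. exact: prodr_ge0. Qed.

Lemma measurable_iter_weight n : measurable_fun setT (iter_weight n).
Proof.
apply: measurable_prod => i _; apply: measurableT_comp => //.
exact: measurable_iter.
Qed.

Lemma iter_weightS n x : iter_weight n.+1 x = iter_weight n (f x) * v x.
Proof.
rewrite /iter_weight big_ord_recl mulrC; congr (_ * _).
by apply: eq_bigr => i _; rewrite -iterSr.
Qed.

(** Cocycle identity over [f]. Through it [iter_integralD] reads time [m + n] for [g] as time [n]
    for the density of [g] at step [m]. *)
Lemma iter_weightD m n x :
  iter_weight (m + n) x = iter_weight m (iter n f x) * iter_weight n x.
Proof.
elim: n x => [|n IH] x; first by rewrite addn0 /iter_weight big_ord0 mulr1.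
by rewrite addnS !iter_weightS IH mulrA -iterSr.
Qed.

Local Open Scope ereal_scope.

Lemma measurable_iter_integrand n (g : X -> \bar R) : measurable_fun setT g ->
  measurable_fun setT (fun x => g (iter n f x) * (iter_weight n x)%:E).
Proof.
move=> mg; apply: emeasurable_funM.
  exact: (measurableT_comp mg (measurable_iter n)).
by apply/measurable_EFinP; exact: measurable_iter_weight.
Qed.

Lemma iter_integrand_ge0 n (g : X -> \bar R) : (forall x, 0 <= g x) ->
  forall x, 0 <= g (iter n f x) * (iter_weight n x)%:E.
Proof. by move=> g0 x; rewrite mule_ge0// lee_fin iter_weight_ge0. Qed.

Lemma iter_integral_ge0 n (g : X -> \bar R) : (forall x, 0 <= g x) -> 0 <= J n g.
Proof. by move=> g0; apply: integral_ge0 => x _; exact: iter_integrand_ge0. Qed.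

Lemma iter_integral0 (g : X -> \bar R) : J 0 g = \int[mu]_x g x.
Proof.
by apply: eq_integral => x _; rewrite /iter_weight big_ord0 mule1.
Qed.

Lemma iter_integralD m n (g : X -> \bar R) :
  J (m + n) g = J n (fun x => g (iter m f x) * (iter_weight m x)%:E).
Proof.
by apply: eq_integral => x _; rewrite iterD iter_weightD EFinM muleA.
Qed.

Lemma le_iter_integral n (g h : X -> \bar R) :
  measurable_fun setT g -> measurable_fun setT h ->
  (forall x, 0 <= g x <= h x) -> J n g <= J n h.
Proof.
move=> mg mh gh.
have g0 x : 0 <= g x by have /andP[] := gh x.
have h0 x : 0 <= h x by have /andP[_] := gh x; exact: le_trans.
apply: ge0_le_integral => //.
- by move=> x _; exact: iter_integrand_ge0.
- exact: measurable_iter_integrand.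
- exact: measurable_iter_integrand.
- move=> x _; apply: lee_wpmul2r; first by rewrite lee_fin iter_weight_ge0.
  by have /andP[] := gh (iter n f x).
Qed.

Lemma iter_integral_add n (g h : X -> \bar R) :
  measurable_fun setT g -> (forall x, 0 <= g x) ->
  measurable_fun setT h -> (forall x, 0 <= h x) ->
  J n (fun x => g x + h x) = J n g + J n h.
Proof.
move=> mg g0 mh h0; rewrite -ge0_integralD//.
- by apply: eq_integral => x _; rewrite ge0_muleDl.
- by move=> x _; exact: iter_integrand_ge0.
- exact: measurable_iter_integrand.
- by move=> x _; exact: iter_integrand_ge0.
- exact: measurable_iter_integrand.
Qed.

Lemma iter_integralZ n (a : R) (g : X -> \bar R) : (0 <= a)%R ->
  measurable_fun setT g -> (forall x, 0 <= g x) ->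
  J n (fun x => a%:E * g x) = a%:E * J n g.
Proof.
move=> a0 mg g0; rewrite -ge0_integralZl_EFin//.
- by apply: eq_integral => x _; rewrite muleA.
- by move=> x _; exact: iter_integrand_ge0.
- exact: measurable_iter_integrand.
Qed.

Lemma iter_integral_nneseries n (h : nat -> X -> \bar R) :
  (forall l, measurable_fun setT (h l)) -> (forall l x, 0 <= h l x) ->
  J n (fun x => \sum_(l <oo) h l x) = \sum_(l <oo) J n (h l).
Proof.
move=> mh h0; rewrite -integral_nneseries//.
- apply: eq_integral => x _; rewrite muleC -nneseriesZl//.
  by apply: eq_eseriesr => l _; rewrite muleC.
- by move=> l; exact: measurable_iter_integrand.
- by move=> l x _; exact: iter_integrand_ge0.
Qed.

(** * Measures of iterated preimages and their growth *)

Lemma measurable_EFin_indic (A : set X) : measurable A ->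
  measurable_fun setT (fun x => (\1_A x : R)%:E).
Proof. by move=> mA; exact/measurable_EFinP. Qed.

Definition iter_measure n (A : set X) : \bar R := J n (fun x => (\1_A x)%:E).
Local Notation nu := iter_measure.

Lemma iter_measureE n (A : set X) :
  nu n A = \int[mu]_(x in iter n f @^-1` A) (iter_weight n x)%:E.
Proof.
rewrite [RHS]integral_mkcond; apply: eq_integral => x _.
rewrite indicE /patch.
have -> : (x \in iter n f @^-1` A) = (iter n f x \in A) by apply/idP/idP; rewrite !inE.
by case: ifP => _; rewrite ?mul1e ?mul0e.
Qed.

Lemma iter_measure_ge0 n A : 0 <= nu n A.
Proof. by apply: iter_integral_ge0 => x; rewrite lee_fin. Qed.

(** The integrand at time [n.+1] is the density at time [n], composed with [f] and multiplied by
    [v]; one use of [ge0_integral_transfer] costs one factor [c]. *)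
Lemma iter_integralS_le n (g : X -> \bar R) : measurable_fun setT g ->
  (forall x, 0 <= g x) -> J n.+1 g <= c%:E * J n g.
Proof.
move=> mg g0; apply: le_trans; last first.
  apply: (ge0_integral_transfer c0 v0 mv mf v_bound
    (measurable_iter_integrand n mg) (iter_integrand_ge0 n g0)).
rewrite le_eqVlt; apply/orP; left; apply/eqP; apply: eq_integral => x _.
by rewrite iter_weightS -iterSr EFinM muleA.
Qed.

Lemma iter_integralD_le m n (g : X -> \bar R) : measurable_fun setT g ->
  (forall x, 0 <= g x) -> J (m + n) g <= (c ^+ m)%:E * J n g.
Proof.
move=> mg g0; elim: m => [|m IH]; first by rewrite mul1e.
rewrite addSn; apply: le_trans (iter_integralS_le _ mg g0) _.
by rewrite exprS EFinM -muleA lee_wpmul2l// lee_fin.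
Qed.

Lemma iter_integral_le n (g : X -> \bar R) : measurable_fun setT g ->
  (forall x, 0 <= g x) -> J n g <= (c ^+ n)%:E * \int[mu]_x g x.
Proof.
by move=> mg g0; rewrite -iter_integral0 -{1}(addn0 n); exact: iter_integralD_le.
Qed.

Lemma iter_measure_le n A : measurable A -> nu n A <= (c ^+ n)%:E * mu A.
Proof.
move=> mA; have -> : mu A = \int[mu]_x (\1_A x)%:E by rewrite integral_indic// setIT.
apply: (iter_integral_le n (measurable_EFin_indic mA)) => x.
by rewrite lee_fin.
Qed.

(** * Bounds tested on level sets of simple functions *)

Import HBNNSimple.

(** Both sides are sums over the levels of [h]. Level 0 contributes nothing, so only positive levels
    are tested; the zero set may have infinite measure. *)
Lemma iter_integral_nnsfun_le n M (h : {nnsfun X >-> R}) :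
  (forall r : R, (0 < r)%R ->
    J n (fun x => (\1_(h @^-1` [set r]) x)%:E) <= M * mu (h @^-1` [set r])) ->
  0 <= M -> J n (fun x => (h x)%:E) <= M * \int[mu]_x (h x)%:E.
Proof.
move=> hM M0.
have ind0 r y : (0 <= (r * \1_(h @^-1` [set r]) y)%:E).
  by rewrite EFinM nnfun_muleindic_ge0.
have mind r : measurable_fun setT (fun x => (\1_(h @^-1` [set r]) x : R)%:E).
  by apply/measurable_EFinP.
rewrite /iter_integral integralT_nnsfun sintegralE.
under eq_integral do rewrite fimfunE -fsumEFin// ge0_mule_fsuml//.
rewrite ge0_integral_fsum//; last 2 first.
- move=> r; apply: (measurable_iter_integrand n
    (g := fun y => (r * \1_(h @^-1` [set r]) y)%:E)).
  by apply/measurable_EFinP; exact: measurable_funM.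
- by move=> r x _; apply: (iter_integrand_ge0 n
    (g := fun y => (r * \1_(h @^-1` [set r]) y)%:E)).
rewrite ge0_mule_fsumr; last by move=> r; exact: nnsfun_mulemu_ge0.
apply: lee_fsum => // r [x _ hxr].
have : (0 <= r)%R by rewrite -hxr.
rewrite le_eqVlt => /predU1P[<-|r0].
  by rewrite mul0e mule0; under eq_integral do rewrite mul0r mul0e; rewrite integral0.
rewrite muleCA; apply: (@le_trans _ _ (r%:E * J n (fun x => (\1_(h @^-1` [set r]) x)%:E))).
  by rewrite -iter_integralZ//; exact: ltW.
apply: lee_wpmul2l; [by rewrite lee_fin ltW|exact: hM].
Qed.

(** Monotone convergence along the standard approximation of [g] reduces the bound to simple
    functions. *)
Lemma iter_integral_approx_le n M (g : X -> \bar R) (mg : measurable_fun setT g) :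
  (forall x, 0 <= g x) -> 0 <= M ->
  (forall j (r : R), (0 < r)%R -> let B := nnsfun_approx measurableT mg j @^-1` [set r] in
    J n (fun x => (\1_B x)%:E) <= M * mu B) ->
  J n g <= M * \int[mu]_x g x.
Proof.
move=> g0 M0 gM; pose h := nnsfun_approx measurableT mg.
have gcvg x : (h j x)%:E @[j --> \oo] --> g x by exact: cvg_nnsfun_approx.
have ndh x : {homo (fun j => (h j x)%:E) : a b / (a <= b)%N >-> a <= b}.
  by move=> a b ab; rewrite lee_fin; exact/lefP/nd_nnsfun_approx.
have hg j x : (h j x)%:E <= g x.
  by rewrite /h nnsfun_approxE; apply: le_approx.
have mh j : measurable_fun setT (fun x => (h j x)%:E) by apply/measurable_EFinP.
have nd x : {homo (fun j => (h j (iter n f x))%:E * (iter_weight n x)%:E) :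
    a b / (a <= b)%N >-> a <= b}.
  by move=> a b ab; rewrite lee_wpmul2r ?ndh// lee_fin iter_weight_ge0.
have -> : J n g = limn (fun j => J n (fun x => (h j x)%:E)).
  rewrite -monotone_convergence//=.
  - apply: eq_integral => x _; apply/esym/cvg_lim => //.
    by apply: cvgeZr => //; exact: gcvg.
  - by move=> j; exact: (measurable_iter_integrand n (mh j)).
  - by move=> j x _; apply: (iter_integrand_ge0 n (g := fun y => (h j y)%:E)) => y;
      rewrite lee_fin.
apply: lime_le.
  apply: ereal_nondecreasing_is_cvgn => a b ab; apply: le_iter_integral => // x.
  by rewrite lee_fin/= ndh// andbT.
apply: nearW => j; apply: (le_trans (iter_integral_nnsfun_le _ M0)); first exact: gM.
apply: lee_wpmul2l => //; apply: ge0_le_integral => //.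
by move=> x _; rewrite lee_fin.
Qed.

(** * From a semi-irregular function to a family of sets *)

(** Semi-irregular means that the orbit integrals come close to 0 without tending to 0. The level
    sets of the densities of every step enter the family, because a bound on the ratios has to be
    applied from a step [m] at which [J m g] is already small. *)
Lemma li_yorke_family_of_semi_irregular (g : X -> \bar R) :
  measurable_fun setT g -> (forall x, 0 <= g x) -> \int[mu]_x g x < +oo ->
  (forall e : R, (0 < e)%R -> forall N, exists2 n, (N <= n)%N & J n g < e%:E) ->
  (exists2 e : R, (0 < e)%R & forall N, exists2 n, (N <= n)%N & e%:E <= J n g) ->
  exists (I : Type) (B : I -> set X), li_yorke_family mu nu B.
Proof.
move=> mg g0 gfin liminf [e e0 limsup].
pose gm m x := g (iter m f x) * (iter_weight m x)%:E.
have mgm m : measurable_fun setT (gm m) by exact: measurable_iter_integrand.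
have gm0 m x : 0 <= gm m x by exact: iter_integrand_ge0.
have Jgm n m : J n (gm m) = J (m + n) g by rewrite iter_integralD.
pose h m j := nnsfun_approx measurableT (mgm m) j.
(* Only positive measure is imposed here; finite measure is derived in [L_gt0]. *)
pose L : set (set X) := [set B | 0 < mu B /\
  exists m j (r : R), (0 < r)%R /\ B = h m j @^-1` [set r]].
have mL B : L B -> measurable B by move=> [_ [m [j [r [_ ->]]]]].
(* Chebyshev's inequality: [r] times the indicator of the level set is at most the approximant,
   hence at most [gm m]. *)
have L_le m j (r : R) n : (0 < r)%R ->
    nu n (h m j @^-1` [set r]) <= (r^-1)%:E * J n (gm m).
  move=> r0; rewrite lee_pdivlMl// -iter_integralZ//; last 2 first.
  - exact: ltW.
  - exact: measurable_EFin_indic.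
  apply: le_iter_integral => //.
    by apply: emeasurable_funM => //; exact: measurable_EFin_indic.
  have r_ge0 : 0 <= r%:E by rewrite lee_fin ltW.
  move=> x; rewrite mule_ge0 ?lee_fin//= indicE.
  have [|_] := boolP (_ \in _); last by rewrite mule0 gm0.
  by rewrite inE => <-; rewrite mule1 /h nnsfun_approxE; apply: le_approx => // y _; exact: gm0.
have countL : countable L.
  apply: (@sub_countable _ _ _ (\bigcup_m \bigcup_j
      ((fun r => h m j @^-1` [set r]) @` range (h m j)))).
    (* A set of positive measure has a point, so its level is one of the finitely many values of
       [h m j]. *)
    apply: subset_card_le => B [B0 [m [j [r [r0 BE]]]]].
    exists m => //; exists j => //; exists r => //.
    have /set0P[x] : B != set0 by apply/eqP => B_0; move: B0; rewrite B_0 measure0 ltxx.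
    by rewrite BE => <-; exists x.
  apply: bigcup_countable => // m _; apply: bigcup_countable => // j _.
  by apply: finite_set_countable; apply: finite_image.
have unbounded (M : R) : (0 <= M)%R ->
    ~ forall B, L B -> forall n, (0 < n)%N -> nu n B <= M%:E * mu B.
  move=> M0 bounded.
  have M1 : (0 < M + 1)%R by rewrite ltr_wpDl.
  (* With [J m g < e / (M + 1)], a bound [M] on the ratios keeps all later integrals below [e]; the
     added 1 covers [M = 0]. *)
  have [m _ mlt] := liminf _ (divr_gt0 e0 M1) 0%N.
  (* Starting from [m.+1] makes [n - m] positive, as the bound on the ratios requires. *)
  have [n mn] := limsup m.+1.
  rewrite -(subnKC (ltnW mn)) -Jgm leNgt => /negP; apply.
  apply: (@le_lt_trans _ _ (M%:E * J m g)).
    have := Jgm 0%N m; rewrite addn0 iter_integral0 => <-.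
    apply: (iter_integral_approx_le (mg := mgm m)) => // j r r0.
    set B := _ @^-1` _ => /=.
    have mB : measurable B by rewrite /B.
    have [B0|] := ltP 0 (mu B).
      by apply: bounded; [split => //; exists m, j, r|rewrite subn_gt0].
    (* A null level set is not in [L], but the growth bound makes its [nu] vanish. *)
    rewrite measure_le0 => /eqP B0.
    by rewrite B0 mule0; apply: le_trans (iter_measure_le _ mB) _; rewrite B0 mule0.
  have [->|Mn0] := eqVneq M 0%R; first by rewrite mul0e lte_fin.
  have M0' : (0 < M)%R by rewrite lt_neqAle eq_sym Mn0.
  apply: (@lt_le_trans _ _ (M%:E * (e / (M + 1))%:E)).
    by rewrite lte_pmul2l.
  rewrite -EFinM lee_fin mulrA ler_pdivrMr// mulrC ler_pM2l//.
  by rewrite lerDl.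
have [n [n0 n_incr n_cvg]] := exists_increasing_cvg0
  (fun n => iter_integral_ge0 n g0) liminf.
have [B0 LB0] : L !=set0.
  (* On an empty [L] the bound [M = 0] would hold vacuously. *)
  apply/set0P/negP => /eqP Lempty; apply: (unbounded 0%R) => // B.
  by rewrite Lempty.
have L_gt0 B : L B -> 0 < mu B < +oo.
  move=> [-> /= [m [j [r [r0 ->]]]]].
  (* At time 0 [nu] is [mu], so Chebyshev's bound and the integrability of [g] give finite
     measure. *)
  have := L_le m j r 0%N r0; rewrite /iter_measure iter_integral0 integral_indic// setIT.
  move/le_lt_trans; apply; rewrite lte_mul_pinfty ?lee_fin ?invr_ge0 ?ltW//.
  rewrite Jgm; apply: le_lt_trans (iter_integral_le _ mg g0) _.
  by rewrite lte_mul_pinfty// lee_fin exprn_ge0.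
have cvgL B : L B -> nu (n j) B @[j --> \oo] --> 0.
  move=> [_ [m [j [r [r0 ->]]]]].
  apply: (@squeeze_cvge _ _ _ _ (cst 0) _
      (fun i => ((r^-1)%:E * (c ^+ m)%:E) * J (n i) g)).
  + apply: nearW => i; rewrite iter_measure_ge0/= -muleA.
    apply: le_trans (L_le _ _ _ _ r0) _.
    rewrite lee_wpmul2l//; first by rewrite lee_fin invr_ge0 ltW.
    by rewrite Jgm; exact: (iter_integralD_le m).
  + exact: cvg_cst.
  + by rewrite -[X in _ --> X](mule0 ((r^-1)%:E * (c ^+ m)%:E)); exact: cvgeZl.
exists (set_type L), (fun B => set_val B); split.
- split; first by rewrite (eq_countable (card_setT _)).
  by exists (SigSub (mem_set LB0)).
- by move=> B; have LB := set_valP B; split; [exact: mL|exact: L_gt0].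
- by exists n; split => // B; exact: cvgL (set_valP B).
(* A supremum other than [+oo] is a nonnegative real, since [L] is nonempty, and would be a bound
   excluded by [unbounded]. *)
- apply: contrapT => supNy.
  set s := ereal_sup _ in supNy.
  have s_ge B k : L B -> (0 < k)%N -> nu k B / mu B <= s.
    move=> LB k0; apply: ereal_sup_ubound => /=.
    by exists (SigSub (mem_set LB)), k.
  have s0 : 0 <= s.
    by apply: le_trans (s_ge B0 1%N LB0 _); rewrite ?mule_ge0 ?inve_ge0 ?iter_measure_ge0//.
  have sE : s = (fine s)%:E by rewrite fineK// ge0_fin_numE// ltey; apply/eqP.
  apply: (unbounded (fine s)); first exact: fine_ge0.
  move=> B LB k k0; have /andP[B_gt0 B_fin] := L_gt0 _ LB.
  have := s_ge B k LB k0; rewrite sE.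
  rewrite -(fineK (x := mu B)) ?ge0_fin_numE// inver gt_eqF ?fine_gt0 ?B_gt0//.
  by rewrite lee_pdivrMr// fine_gt0// B_gt0.
Qed.

(** * From a family of sets to a semi-irregular function *)

Let c1 : (1 <= c + 1)%R. Proof. by rewrite lerDr. Qed.

(** Powers of [c + 1], unlike those of [c], always increase with the exponent, so one constant
    serves all times up to [n]. *)
Lemma iter_measure_le1 m n A : (m <= n)%N -> measurable A -> nu m A <= ((c + 1) ^+ n)%:E * mu A.
Proof.
move=> mn mA; apply: (le_trans (iter_measure_le m mA)).
rewrite lee_wpmul2r// lee_fin; apply: (@le_trans _ _ ((c + 1) ^+ m)%R).
  by rewrite lerXn2r ?nnegrE ?addr_ge0// lerDl.
exact: ler_weXn2l.
Qed.

(** By (B) some ratio exceeds any given [K]. Dividing the indicator by [K * mu (B i)] makes it cheap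
    up to time [N], yet of integral at least 1 at the later time [m]. *)
Lemma exists_hump I (B : I -> set X) (N : nat) : li_yorke_family mu nu B ->
  exists (a : R) (i : I) (m : nat), [/\ (0 < a)%R, (N < m)%N,
    ((c + 1) ^+ N)%:E * (a%:E * mu (B i)) <= (2^-1 ^+ N * 2^-1 ^+ N)%:E &
    1 <= a%:E * nu m (B i)].
Proof.
move=> [_ mB _ sup].
pose e : R := (2^-1 ^+ N)%R.
have e0 : (0 < e)%R by rewrite exprn_gt0// invr_gt0.
have e1 : (e <= 1)%R by rewrite exprn_ile1// invf_le1// ler1n.
have C0 : (0 < (c + 1) ^+ N)%R by rewrite exprn_gt0// (lt_le_trans _ c1).
(* [K] is [(c + 1)^N * 4^N]: the growth factor up to time [N] over the allowed cost. *)
pose K : R := ((c + 1) ^+ N / (e * e))%R.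
have K0 : (0 < K)%R by rewrite divr_gt0// mulr_gt0.
have : K%:E < ereal_sup [set r : \bar R | exists (i : I) (n : nat), (0 < n)%N /\
        r = (nu n (B i) / mu (B i))%E] by rewrite sup ltry.
move=> /ereal_sup_gt[_ [i [m [_ ->]]]].
have [mBi /andP[B0 Boo]] := mB i.
have bE : mu (B i) = (fine (mu (B i)))%:E by rewrite fineK// ge0_fin_numE.
move: (fine _) bE B0 => b bE; rewrite bE lte_fin => b0.
rewrite inver gt_eqF// lte_pdivlMr// => Knu.
exists (K * b)^-1%R, i, m; split.
- by rewrite invr_gt0 mulr_gt0.
(* For [m <= N] the growth bound would keep the ratio at most [K]. *)
- rewrite ltnNge; apply/negP => /iter_measure_le1 /(_ mBi); rewrite leNgt => /negP; apply.
  apply: le_lt_trans Knu; rewrite bE -!EFinM lee_fin ler_pM2r//.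
  rewrite /K ler_pdivlMr ?mulr_gt0// ler_piMr ?(ltW C0)//.
  by rewrite mulr_ile1// ltW.
- rewrite bE -!EFinM lee_fin -/e /K le_eqVlt; apply/orP; left; apply/eqP.
  by field; rewrite !gt_eqF.
- rewrite lee_pdivlMl; last exact: mulr_gt0.
  by rewrite mule1 EFinM; exact: ltW.
Qed.

(** Gliding hump: at time [N k] the earlier humps have decayed by (A), and the hump [N k] and later
    ones are still cheap. *)
Lemma semi_irregular_of_li_yorke_family I (B : I -> set X) :
  li_yorke_family mu nu B ->
  exists g : X -> R, [/\ measurable_fun setT g, forall x, (0 <= g x)%R,
    \int[mu]_x (g x)%:E < +oo,
    forall e : R, (0 < e)%R -> forall N, exists2 n, (N <= n)%N &
      J n (fun x => (g x)%:E) < e%:E &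
    forall N, exists2 n, (N <= n)%N & 1 <= J n (fun x => (g x)%:E)].
Proof.
move=> famB; have [_ mB [n [n_gt0 n_incr n_cvg]] _] := famB.
pose e k : R := (2^-1 ^+ k)%R.
have e_ge0 k : (0 <= e k)%R by rewrite exprn_ge0// invr_ge0.
have e_gt0 k : (0 < e k)%R by rewrite exprn_gt0// invr_gt0.
have e_anti k l : (k <= l)%N -> (e l <= e k)%R.
  by move=> kl; apply: ler_wiXn2l => //; rewrite invf_le1// ler1n.
have /choice[hump humpP] N : exists aim : R * I * nat, [/\ (0 < aim.1.1)%R,
    (N < aim.2)%N,
    ((c + 1) ^+ N)%:E * (aim.1.1%:E * mu (B aim.1.2)) <= (e N * e N)%:E &
    1 <= aim.1.1%:E * nu aim.2 (B aim.1.2)].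
  by have [a [i [m ?]]] := exists_hump N famB; exists (a, i, m).
pose a N := (hump N).1.1; pose A N := B (hump N).1.2; pose m N := (hump N).2.
have a0 N : (0 < a N)%R by have [] := humpP N.
have mA N : measurable (A N) by exact: (mB _).1.
pose h N (x : X) : \bar R := (a N)%:E * (\1_(A N) x)%:E.
have h0 N x : 0 <= h N x by rewrite mule_ge0 ?lee_fin// ltW.
have mh N : measurable_fun setT (h N).
  by apply: emeasurable_funM => //; exact: measurable_EFin_indic.
have Jh k N : J k (h N) = (a N)%:E * nu k (A N).
  by rewrite iter_integralZ//; [exact: ltW|exact: measurable_EFin_indic].
(* [F N] is one of the times of (A), taken so late that the finitely many humps up to [N] are all
   small at once. *)
have /choice[F FP] N : exists k, (N < k)%N /\
    forall l, (l <= N)%N -> J k (h l) <= (e N * e l)%:E.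
  have near_l (l : 'I_N.+1) : \forall j \near \oo, J (n j) (h l) < (e N * e l)%:E.
    have : J (n j) (h l) @[j --> \oo] --> 0.
      rewrite -[X in _ --> X](mule0 (a l)%:E).
      under eq_fun do rewrite Jh.
      by apply: cvgeZl => //; exact: n_cvg.
    move=> /(_ [set x | x < (e N * e l)%:E]); apply.
    by apply: open_ereal_lt'; rewrite lte_fin mulr_gt0.
  have n_ge j : (j <= n j)%N.
    by elim: j => // j IH; apply: leq_ltn_trans IH _; exact: n_incr.
  have := filter_forall _ near_l.
  move=> /(_ _)/filterI/(_ (nbhs_infty_gt N))/filter_ex[j [/= jl Nj]].
  exists (n j); split; first exact: leq_trans Nj (n_ge j).
  by move=> l lN; apply: ltW; exact: (jl (Ordinal (lN : (l < N.+1)%N))).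
pose N k := iter k F 0%N.
have N_incr : {homo N : i j / (i < j)%N}.
  by apply: homo_ltn => [|k]; [exact: ltn_trans|exact: (FP _).1].
have N_le : {homo N : i j / (i <= j)%N}.
  by move=> i j; rewrite leq_eqVlt => /predU1P[->//|/N_incr/ltnW].
have N_ge k : (k <= N k)%N.
  by elim: k => // k IH; apply: leq_ltn_trans IH _; exact: N_incr.
(* The bound is [2 * e k * e l], in the shape summed by [epsilon_trick0]. The factor 2 pays for
   [N k.+1] being chosen with precision [e (N k)]. *)
have J_small k l : J (N k) (h (N l)) <= (4 * e k / (2 ^ l.+1)%:R)%:E.
  have -> : (4 * e k / (2 ^ l.+1)%:R = 2 * e k * e l)%R.
    by rewrite /e natrX exprS invfM !exprVn; field; rewrite ?expf_neq0.
  have [lk|kl] := ltnP l k.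
    case: k lk => // k; rewrite ltnS => lk.
    apply: (le_trans ((FP (N k)).2 _ (N_le _ _ lk))).
    rewrite lee_fin {3}/e exprS mulrA divff// mul1r.
    by rewrite ler_pM// e_anti.
  have [_ _ + _] := humpP (N l).
  rewrite Jh => cost; apply: (@le_trans _ _ (e (N l) * e (N l))%:E).
    apply: le_trans cost; rewrite muleCA lee_wpmul2l//.
      by rewrite lee_fin ltW.
    by apply: iter_measure_le1 => //; exact: N_le.
  rewrite lee_fin ler_pM//; last exact: e_anti.
  apply: (@le_trans _ _ (e k)); first by rewrite e_anti// (leq_trans kl).
  by rewrite ler_peMl// ler1n.
pose G x := \sum_(l <oo) h (N l) x.
have G0 x : 0 <= G x by exact: nneseries_ge0.
have mG : measurable_fun setT G by exact: ge0_emeasurable_sum.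
have J_G k : J (N k) G <= (4 * e k)%:E.
  rewrite iter_integral_nneseries//.
  apply: le_trans (epsilon_trick0 xpredT _); last by rewrite mulr_ge0.
  apply: lee_nneseries => [l _ _|l _]; last exact: J_small.
  exact: iter_integral_ge0.
have G_fin : \int[mu]_x G x < +oo.
  (* Here [N 0] is 0, so the case [k = 0] of [J_G] bounds the integral itself. *)
  by rewrite -iter_integral0 (le_lt_trans (J_G 0%N))// ltry.
(* [G] may be infinite on the null set [D], where [fine] returns 0. *)
pose D := ~` [set x | G x \is a fin_num].
have mD : measurable D.
  by apply: measurableC; rewrite -[X in measurable X]setTI; exact: emeasurable_fin_num.
have D0 : mu D = 0.
  apply: measure_negligible => //.
  have : mu.-integrable setT G.
    by apply/integrableP; split => //; under eq_integral do rewrite gee0_abs//.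
  move/integrable_ae => /(_ measurableT).
  apply: negligibleS => x /= nfin; apply: contra_not nfin; exact.
pose g x := fine (G x).
have mg : measurable_fun setT g by apply: measurableT_comp => //; exact: fine_measurable.
have g0 x : (0 <= g x)%R by exact: fine_ge0.
have gG x : (g x)%:E <= G x.
  by rewrite /g; case: (G x) (G0 x) => //= _; exact: leey.
have Jg k : J k (fun x => (g x)%:E) <= J k G.
  apply: le_iter_integral => //; first exact/measurable_EFinP.
  by move=> x; rewrite lee_fin g0 gG.
exists g; split => //.
- apply: le_lt_trans G_fin; apply: ge0_le_integral => //.
  + by move=> x _; rewrite lee_fin.
  + exact/measurable_EFinP.
- move=> eps eps0 M.
  have : \forall k \near \oo, (4 * e k < eps)%R.
    have e_cvg : e k @[k --> \oo] --> (0 : R)%R.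
      by apply: cvg_expr; rewrite ger0_norm ?invr_ge0// invf_lt1// ltr1n.
    have eps4 : (0 < eps / 4)%R by rewrite divr_gt0.
    have [k0 _ k0P] := cvgr_lt _ e_cvg _ eps4.
    by exists k0 => // k /k0P /=; rewrite ltr_pdivlMr// mulrC.
  move=> /filterI/(_ (nbhs_infty_ge M))/filter_ex[k [/= keps Mk]].
  exists (N k); first exact: leq_trans Mk (N_ge k).
  apply: le_lt_trans (Jg _) _; apply: le_lt_trans (J_G k) _.
  by rewrite lte_fin.
- move=> M; have [_ Nm _ large] := humpP (N M).
  exists (m (N M)); first exact: leq_trans (N_ge M) (ltnW Nm).
  apply: (le_trans large); rewrite -Jh.
  (* Off [D] the hump is a term of the series [G = g]. On [D], where [g] is 0, the added indicator
     dominates it, and this term has zero integral because [D] is null. *)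
  have haD x : h (N M) x <= (g x)%:E + (a (N M))%:E * (\1_D x)%:E.
    have [Gx|Gx] := boolP (G x \is a fin_num).
      apply: (@le_trans _ _ (g x)%:E); last first.
        by rewrite leeDl// mule_ge0// lee_fin// ltW.
      rewrite /g fineK//; apply: le_trans (nneseries_lim_ge M.+1 _) => //.
      by rewrite big_nat_recr//= leeDr// sume_ge0.
    have xD : x \in D by rewrite inE; exact/negP.
    rewrite [in leRHS]indicE xD mule1 -[leLHS]add0e; apply: leeD.
      by rewrite lee_fin.
    rewrite -[leRHS]mule1; apply: lee_wpmul2l; first by rewrite lee_fin ltW.
    by rewrite lee_fin indicE; case: (_ \in _).
  apply: (@le_trans _ _ (J (m (N M)) (fun x =>
      (g x)%:E + (a (N M))%:E * (\1_D x)%:E))).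
    apply: le_iter_integral => //.
      apply: emeasurable_funD; first exact/measurable_EFinP.
      by apply: emeasurable_funM => //; exact: measurable_EFin_indic.
    by move=> x; rewrite h0 haD.
  have aD0 x : 0 <= (a (N M))%:E * (\1_D x)%:E.
    by rewrite mule_ge0// lee_fin// ltW.
  have maD : measurable_fun setT (fun x => (a (N M))%:E * (\1_D x)%:E).
    by apply: emeasurable_funM => //; exact: measurable_EFin_indic.
  have mgE : measurable_fun setT (fun x => (g x)%:E) by exact/measurable_EFinP.
  rewrite iter_integral_add//.
  rewrite iter_integralZ//; [|exact: ltW|exact: measurable_EFin_indic].
  have : nu (m (N M)) D = 0.
    apply/eqP; rewrite eq_le iter_measure_ge0 andbT (le_trans (iter_measure_le _ mD))//.
    by rewrite D0 mule0.
  by rewrite /iter_measure => ->; rewrite mule0 adde0.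
Qed.

End weighted_iterates.

(** * Lower and upper limits of real sequences *)

Lemma limn_einf_eq0P (R : realType) (u : nat -> R) : (forall n, 0 <= u n) ->
  limn_einf (EFin \o u) = 0%E <->
  forall e, 0 < e -> forall N, exists2 n, (N <= n)%N & u n < e.
Proof.
move=> u0; rewrite -[limn_einf _]/(limf_einf _ _) limf_einfE; split=> [inf0 e e0 N|inf_small].
  apply: contrapT => no.
  suff : (e%:E <= 0)%E by rewrite lee_fin leNgt e0.
  rewrite -inf0; apply: le_ereal_sup_tmp.
  exists (ereal_inf ((EFin \o u) @` [set n | (N <= n)%N])).
    by exists [set n | (N <= n)%N] => //; exact: nbhs_infty_ge.
  apply: le_ereal_inf_tmp => _ [n /= Nn <-].
  by rewrite lee_fin leNgt; apply/negP => une; apply: no; exists n.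
apply/eqP; rewrite eq_le; apply/andP; split.
  apply: ge_ereal_sup => _ [V [N _ NV] <-].
  apply/lee_addgt0Pr => e e0; rewrite add0e.
  have [n Nn une] := inf_small e e0 N.
  apply: ge_ereal_inf; exists (u n)%:E; last by rewrite lee_fin ltW.
  by exists n => //; exact: NV.
apply: le_ereal_sup_tmp; exists (ereal_inf ((EFin \o u) @` setT)).
  by exists setT => //; exact: filterT.
by apply: le_ereal_inf_tmp => _ [n _ <-]; rewrite lee_fin.
Qed.

Lemma limn_esup_gt0P (R : realType) (u : nat -> R) :
  (0 < limn_esup (EFin \o u))%E <->
  exists2 e, 0 < e & forall N, exists2 n, (N <= n)%N & e <= u n.
Proof.
rewrite /limn_esup limf_esupE; split=> [sup_gt0|[e e0 large]].
  apply: contrapT => no.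
  move: sup_gt0; rewrite ltNge => /negP; apply.
  apply/lee_addgt0Pr => e e0; rewrite add0e.
  have [N uN] : exists N, forall n, (N <= n)%N -> u n < e.
    apply: contrapT => /forallNP noN; apply: no; exists e => // N.
    have /existsNP[n /not_implyP[Nn /negP]] := noN N.
    by rewrite -leNgt; exists n.
  apply: ge_ereal_inf; exists (ereal_sup ((EFin \o u) @` [set n | (N <= n)%N])).
    by exists [set n | (N <= n)%N] => //; exact: nbhs_infty_ge.
  by apply: ge_ereal_sup => _ [n /= Nn <-]; rewrite lee_fin ltW// uN.
apply: (@lt_le_trans _ _ e%:E); first by rewrite lte_fin.
apply: le_ereal_inf_tmp => _ [V [N _ NV] <-].
have [n Nn une] := large N.
apply: le_ereal_sup_tmp; exists (u n)%:E; last by rewrite lee_fin.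
by exists n => //; exact: NV.
Qed.

(** * Real scalars, powers and moduli *)

Definition real_scalar (R : realType) (k : scalars) : R -> scalar_field R k :=
  match k with
  | RealScalars => fun x => x
  | ComplexScalars => fun x => x%:C%C
  end.

Lemma modulus_real_scalarB (R : realType) k (x y : R) :
  modulus (real_scalar k x - real_scalar k y) = `|x - y|.
Proof.
case: k => //=.
by rewrite subrr expr0n addr0 sqrtr_sqr.
Qed.

Lemma measurable_real_scalar d (X : measurableType d) (R : realType) k (g : X -> R) :
  measurable_fun setT g ->
  measurable_fun setT (fun x => real_scalar k (g x) : borel_scalar R k).
Proof.
case: k => mg; first exact/measurable_real_scalarP.
by apply/measurable_complex_scalarP; split => //; exact: measurable_cst.
Qed.

Lemma ltr_powR2r (R : realType) (p x y : R) : 0 < p -> 0 <= x -> 0 <= y ->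
  (x `^ p < y `^ p) = (x < y).
Proof.
move=> p0 x0 y0; have [xy|yx] := ltP x y; first by rewrite gt0_ltr_powR.
by apply/negbTE; rewrite -leNgt ge0_ler_powR// ltW.
Qed.

Lemma modulus_prod (R : realType) k n (F : 'I_n -> scalar_field R k) :
  modulus (\prod_(i < n) F i) = \prod_(i < n) modulus (F i).
Proof.
apply: (big_morph modulus (@modulusM R k)).
by case: k {F} => /=; [exact: normr1|exact: ComplexField.Normc.normc1].
Qed.

(** * Orbits of the operator expressed by orbit integrals *)

Section Lp_iterates.
Context d (X : measurableType d) (R : realType) (k : scalars).
Variables (mu : {measure set X -> \bar R}) (p : R).
Variables (w : X -> scalar_field R k) (f : X -> X).
Hypothesis p1 : 1 <= p.
Hypothesis mw : measurable_fun setT (w : X -> borel_scalar R k).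
Hypothesis f_bimeas : bimeasurable f.
Hypothesis f_bound : exists c : R, 0 < c /\
  forall A, measurable A ->
    (\int[mu]_(x in A) (modulus (w x) `^ p)%:E <= c%:E * mu (f @` A))%E.

Local Notation v := (fun x => modulus (w x) `^ p).
Local Notation J := (iter_integral mu f v).
Local Notation C := (weighted_comp_op (p1 := p1)
  (is_Lp_weighted_comp p1 mw f_bimeas f_bound)).

Let p_gt0 : 0 < p. Proof. exact: lt_le_trans p1. Qed.

(** [weighted_comp_opE] allows each step to be computed on a chosen representative, so the formula
    holds at every point and not just almost everywhere. *)
Lemma iter_weighted_comp_opE n (phi : Lp_fun k mu p) : exists psi : Lp_fun k mu p,
  iter n C (\pi_(Lp_space k mu p1)%qT phi) = \pi_(Lp_space k mu p1)%qT psi /\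
  forall x, psi x = phi (iter n f x) * \prod_(i < n) w (iter i f x).
Proof.
elim: n => [|n [psi [E psiE]]].
  by exists phi; split => // x; rewrite big_ord0 mulr1.
exists (MkLp (is_Lp_weighted_comp p1 mw f_bimeas f_bound (Lp_valP psi))); split.
  by rewrite iterS E weighted_comp_opE.
move=> x /=; rewrite /weighted_comp psiE -iterSr -mulrA; congr (_ * _).
rewrite big_ord_recl mulrC; congr (_ * _).
by apply: eq_bigr => i _; rewrite -iterSr.
Qed.

(** The bridge from dynamics to integrals: linearity reduces to the difference, and the power [p]
    undoes the root in the norm. *)
Lemma Lp_mdist_iterE n (phi psi : Lp_fun k mu p) :
  (mdist (iter n C (\pi_(Lp_space k mu p1)%qT phi))
         (iter n C (\pi_(Lp_space k mu p1)%qT psi)) `^ p)%:E =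
  J n (fun x => (modulus (phi x - psi x) `^ p)%:E).
Proof.
have [phin [-> phinE]] := iter_weighted_comp_opE n phi.
have [psin [-> psinE]] := iter_weighted_comp_opE n psi.
rewrite Lp_mdistE -poweR_EFin fineK ?Lp_edist_fin_num//.
rewrite poweR_Lnorm ?gt_eqF//; apply: eq_integral => x _ /=.
rewrite phinE psinE -mulrBl modulusM ger0_norm ?mulr_ge0 ?modulus_ge0//.
rewrite powRM ?modulus_ge0// EFinM; congr (_ * _%:E)%E.
rewrite modulus_prod.
suff [] : 0 <= \prod_(i < n) modulus (w (iter i f x)) /\
    (\prod_(i < n) modulus (w (iter i f x))) `^ p = iter_weight f v n x by [].
(* Nonnegativity is carried through the induction because [powRM] needs it. *)
apply: (big_ind2 (fun a b => 0 <= a /\ a `^ p = b)).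
- by rewrite powR1.
- by move=> a _ b _ [a0 <-] [b0 <-]; rewrite mulr_ge0// powRM.
- by move=> i _; rewrite modulus_ge0.
Qed.

Let v_ge0 x : 0 <= v x. Proof. exact: powR_ge0. Qed.

Let mv : measurable_fun setT v.
Proof.
apply: (@measurableT_comp _ _ _ _ _ _ (fun y => y `^ p)) => //.
exact: measurable_modulus.
Qed.

Let mf : measurable_fun setT f.
Proof. by move=> _ A mA; rewrite setTI; exact: f_bimeas.2. Qed.

(** The hypothesis is applied to the preimage of [B], whose image under [f] lies in [B]. *)
Let v_bound : exists2 c : R, 0 <= c & forall B, measurable B ->
  (\int[mu]_(x in f @^-1` B) (v x)%:E <= c%:E * mu B)%E.
Proof.
have [c [c0 wc]] := f_bound; exists c => [|B mB]; first exact: ltW.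
apply: (le_trans (wc _ (f_bimeas.2 _ mB))).
rewrite lee_wpmul2l ?lee_fin ?(ltW c0)//; apply: le_measure.
- by rewrite inE; apply: f_bimeas.1; exact: f_bimeas.2.
- by rewrite inE.
- exact: image_preimage_subset.
Qed.

Let weighted_measureE : (fun n A => weighted_measure mu p w f n (iter n f @^-1` A)) =
  iter_measure mu f v.
Proof. by apply/funext => n; apply/funext => A; rewrite iter_measureE. Qed.

Lemma li_yorke_family_of_chaotic : li_yorke_chaotic C ->
  exists (I : Type) (B : I -> set X), li_yorke_family mu
    (fun n A => weighted_measure mu p w f n (iter n f @^-1` A)) B.
Proof.
move=> [_ [S [uncountable chaos]]].
(* A single scrambled pair suffices; a set without two distinct points is countable. *)
have [x [y [Sx Sy xy]]] : exists x y, [/\ S x, S y & x <> y].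
  apply: contrapT => no; apply: uncountable.
  have [->|/set0P[x Sx]] := eqVneq S set0; first exact: countable0.
  apply: (@sub_countable _ _ _ [set x]) => //; apply: subset_card_le => y Sy /=.
  by apply: contrapT => yx; apply: no; exists y, x.
pose g z := modulus (repr x z - repr y z) `^ p.
have mg : measurable_fun setT (fun z => (g z)%:E).
  apply/measurable_EFinP; apply: (@measurableT_comp _ _ _ _ _ _ (fun y => y `^ p)) => //.
  exact: measurable_Lp_modulusB.
have g0 z : (0 <= (g z)%:E)%E by rewrite lee_fin powR_ge0.
pose u n := mdist (iter n C x) (iter n C y).
have u0 n : 0 <= u n by exact: mdist_ge0.
have uE n : (u n `^ p)%:E = J n (fun z => (g z)%:E).
  by rewrite -Lp_mdist_iterE !reprK.
have [/(limn_einf_eq0P u0) small /limn_esup_gt0P[e e0 large]] := chaos x y Sx Sy xy.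
have [c c0 vc] := v_bound.
rewrite weighted_measureE.
apply: (li_yorke_family_of_semi_irregular mf mv v_ge0 c0 vc mg g0).
- by rewrite -(iter_integral0 mu f v) -uE ltry.
(* The threshold for distances is [r] to the power [p^-1], because [J] is the [p]-th power of a
   distance. *)
- move=> r r0 N; have [n Nn un] := small _ (powR_gt0 p^-1 r0) N.
  exists n => //; rewrite -uE lte_fin.
  by rewrite -[ltRHS]powRr1 ?(ltW r0)// -(@mulVf _ p) ?gt_eqF// powRrM ltr_powR2r// powR_ge0.
- exists (e `^ p); first exact: powR_gt0.
  move=> N; have [n Nn eu] := large N; exists n => //.
  by rewrite -uE lee_fin ge0_ler_powR// ?nnegrE// ltW.
Qed.

(** One [g] serves all pairs: by [distE] the parameters [s] and [t] only contribute the factor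
    [|s - t|^p]. *)
Lemma chaotic_of_li_yorke_family (I : Type) (B : I -> set X) :
  li_yorke_family mu
    (fun n A => weighted_measure mu p w f n (iter n f @^-1` A)) B ->
  li_yorke_chaotic C.
Proof.
rewrite weighted_measureE => famB; have [c c0 vc] := v_bound.
have [g [mg g0 gfin small large]] :=
  semi_irregular_of_li_yorke_family mf mv v_ge0 c0 vc famB.
split; first exact: weighted_comp_op_continuous.
pose phi t x := real_scalar k (t * g x `^ p^-1).
have phi_p s t x : modulus (phi s x - phi t x) `^ p = `|s - t| `^ p * g x.
  rewrite modulus_real_scalarB -mulrBl normrM powRM// (ger0_norm (powR_ge0 _ _)).
  by rewrite -powRrM mulVf ?gt_eqF// powRr1.
have mroot : measurable_fun setT (fun x => g x `^ p^-1).
  exact: (@measurableT_comp _ _ _ _ _ _ (fun y => y `^ p^-1)).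
have Lphi t : is_Lp mu p (phi t).
  split; first by apply: measurable_real_scalar; exact: measurable_funM.
  rewrite /finite_norm; apply: (@lty_poweRy _ _ p); first by rewrite gt_eqF.
  rewrite poweR_Lnorm ?gt_eqF//.
  rewrite (_ : (\int[mu]_x _)%E = (`|t| `^ p)%:E * \int[mu]_x (g x)%:E)%E.
    by rewrite lte_mul_pinfty// ?lee_fin ?powR_ge0.
  rewrite -ge0_integralZl_EFin ?powR_ge0//; last 2 first.
  - by move=> x _; rewrite lee_fin.
  - exact/measurable_EFinP.
  apply: eq_integral => x _ /=.
  (* The parameter 0 gives the zero function, so [phi_p] also computes the modulus of [phi t]. *)
  have := phi_p t 0 x; rewrite -EFinM subr0 => <-; rewrite /phi mul0r.
  rewrite ger0_norm ?modulus_ge0//; congr (modulus _ `^ p)%:E.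
  by rewrite /real_scalar; case: (k) => /=; rewrite subr0.
pose P t := \pi_(Lp_space k mu p1)%qT (MkLp (Lphi t)).
have distE n s t : (mdist (iter n C (P s)) (iter n C (P t)) `^ p)%:E =
    ((`|s - t| `^ p)%:E * J n (fun x => (g x)%:E))%E.
  rewrite Lp_mdist_iterE -(iter_integralZ _ mf mv v_ge0) ?powR_ge0//.
  - by congr (J n _); apply/funext => x; rewrite -EFinM -phi_p.
  - exact/measurable_EFinP.
have P_inj s t : P s = P t -> s = t.
  (* A time with [J n g >= 1] shows that [g] is not null, so equal classes force [|s - t| = 0]. *)
  move=> Pst; have [n _ n_large] := large 0%N.
  have := distE n s t; rewrite Pst mdistxx powR0 ?gt_eqF// => /esym/eqP.
  rewrite mule_eq0 => /orP[|/eqP J0]; last by move: n_large; rewrite J0 lee_fin ler10.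
  by rewrite eqe powR_eq0 normr_eq0 subr_eq0 => /andP[/eqP].
exists (P @` `[0, 1]); split.
  rewrite (eq_countable (inj_card_eq _)); last by move=> s t _ _; exact: P_inj.
  (* The unit interval is uncountable, having Lebesgue measure 1. *)
  move=> /countable_lebesgue_measure0; rewrite lebesgue_measure_itv/= lte_fin ltr01.
  by rewrite oppr0 adde0 => /eqP; rewrite onee_eq0.
move=> _ _ [s _ <-] [t _ <-] Pst.
have st : 0 < `|s - t|.
  by rewrite normr_gt0 subr_eq0; apply/eqP => E; apply: Pst; rewrite E.
have st_p := powR_gt0 p st.
split.
  apply/limn_einf_eq0P => [n|e e0 N]; first exact: mdist_ge0.
  have [n Nn Jn] := small (e `^ p / `|s - t| `^ p) (divr_gt0 (powR_gt0 p e0) st_p) N.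
  exists n => //; rewrite -(@ltr_powR2r _ p) ?mdist_ge0 ?(ltW e0)//.
  by rewrite -lte_fin distE -lte_pdivlMl// -EFinM mulrC.
(* Whenever [J n g >= 1], the distance is at least [|s - t|]. *)
apply/limn_esup_gt0P; exists `|s - t| => // N.
have [n Nn Jn] := large N; exists n => //.
rewrite leNgt -(@ltr_powR2r _ p) ?mdist_ge0// -leNgt -lee_fin distE.
by rewrite -[leLHS]mule1 lee_wpmul2l// lee_fin powR_ge0.
Qed.
End Lp_iterates.

Unset Implicit Arguments.
Set Strict Implicit.

Theorem theorem10 (R : realType) (k : scalars) (p : R) (p1 : 1 <= p)
    (d : measure_display) (X : measurableType d) (mu : {measure set X -> \bar R})
    (w : X -> scalar_field R k) (f : X -> X)
    (mw : measurable_fun [set: X] (w : X -> borel_scalar R k))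
    (w_mul : forall phi : X -> scalar_field R k,
      is_Lp mu p phi -> is_Lp mu p (fun x => phi x * w x))
    (f_bimeas : bimeasurable f)
    (f_bound : exists c : R, 0 < c /\
      forall A : set X, measurable A ->
        (\int[mu]_(x in A) (modulus (w x) `^ p)%:E <= c%:E * mu (f @` A))%E) :
  li_yorke_chaotic
    (weighted_comp_op (p1 := p1) (is_Lp_weighted_comp p1 mw f_bimeas f_bound))
  <->
  exists (I : Type) (B : I -> set X),
    [/\ countable [set: I] /\ [set: I] !=set0,
        forall i, measurable (B i) /\ (0 < mu (B i) < +oo)%E,
        exists n : nat -> nat,
          [/\ forall j, (0 < n j)%N,
              {homo n : a b / (a < b)%N} &
              forall i, weighted_measure mu p w f (n j) (iter (n j) f @^-1` B i)
                          @[j --> \oo] --> 0%E]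
      & ereal_sup [set r : \bar R | exists (i : I) (n : nat), (0 < n)%N /\
          r = (weighted_measure mu p w f n (iter n f @^-1` B i) / mu (B i))%E]
        = +oo%E].
Proof.
split; first exact: li_yorke_family_of_chaotic.
by move=> [I [B famB]]; exact: chaotic_of_li_yorke_family famB.
Qed.
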